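(* Assume (H0) and (H1). Moreover, let $\sigma$ be Lipschitz and of class $C^1(\mathbb{R}^n)$. Let $0<t_*\le T$ and suppose that $\ell(t_*,x)$ is a singleton for every $x\in\mathbb{R}^n$. Then the function $u(t,x)=\min_{y\in\mathbb{R}^n}\{\sigma(y)+tH^*(\frac{x-y}{t})\}$ is continuously differentiable on the open strip $(0,t_* )\times\mathbb{R}^n$.
   Context: Let $T>0$, $H:\mathbb{R}^n\to\mathbb{R}$, $\sigma:\mathbb{R}^n\to\mathbb{R}$. $H^*(z)=\max_{y\in\mathbb{R}^n}\{\langle z,y\rangle-H(y)\}$ is the Fenchel conjugate of $H$. (H0): $H$ is strictly convex on $\mathbb{R}^n$ and superlinear, i.e. $\lim_{\|p\|\to\infty}H(p)/\|p\|=+\infty$. (H1): $\sigma$ is continuous on $\mathbb{R}^n$ and for every $(t_0,x_0)\in[0,T)\times\mathbb{R}^n$ there exist constants $r,N>0$ such that $\min_{\|y\|\le N}\{\sigma(y)+tH^*(\frac{x-y}{t})\}<\sigma(z)+tH^*(\frac{x-z}{t})$ whenever $\|z\|>N$, $t\in(0,T)$ and $|t-t_0|+\|x-x_0\|<r$. (Given (H0), this is automatic when $\sigma$ is Lipschitz.) For $(t,x)\in(0,T]\times\mathbb{R}^n$, $\ell(t,x)$ is the set of global minimizers over $y\in\mathbb{R}^n$ of $y\mapsto\sigma(y)+tH^*(\frac{x-y}{t})$. *)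

(* Defs.v *)
From HB Require Import structures.
From mathcomp Require Import all_boot all_order all_algebra.
From mathcomp Require Import all_classical all_reals all_analysis.

Set Implicit Arguments.
Unset Strict Implicit.
Unset Printing Implicit Defensive.

Import Order.TTheory GRing.Theory Num.Theory.
Import numFieldNormedType.Exports.

Local Open Scope classical_set_scope.
Local Open Scope ring_scope.

(* The least (greatest) element of A, or 0 if there is none. Unlike inf and
   sup, these require the extremum to be attained. *)
Definition setmin (R : realType) (A : set R) : R := xget 0 (A `&` lbound A).
Definition setmax (R : realType) (A : set R) : R := xget 0 (A `&` ubound A).

Lemma setminE (R : realType) (A : set R) (m : R) :
  A m -> lbound A m -> setmin A = m.
Proof.
move=> Am lAm; apply: xget_unique => // y [Ay lAy].
by apply/eqP; rewrite eq_le lAy ?lAm.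
Qed.

Lemma setmaxE (R : realType) (A : set R) (m : R) :
  A m -> ubound A m -> setmax A = m.
Proof.
move=> Am uAm; apply: xget_unique => // y [Ay uAy].
by apply/eqP; rewrite eq_le uAm ?uAy.
Qed.

Definition dot (R : realType) (n : nat) (x y : 'rV[R]_n) : R :=
  \sum_(i < n) x 0 i * y 0 i.

(* The library norm `|x| on 'rV[R]_n is the sup norm; it induces the same
   topology, differentials and Lipschitz functions as the Euclidean one. *)
Definition enorm (R : realType) (n : nat) (x : 'rV[R]_n) : R :=
  Num.sqrt (dot x x).

Definition strictly_convex (R : realType) (V : lmodType R) (f : V -> R) :=
  forall (p q : V) (a : R), p != q -> 0 < a -> a < 1 ->
    f (a *: p + (1 - a) *: q) < a * f p + (1 - a) * f q.

Definition superlinear (R : realType) (n : nat) (H : 'rV[R]_n -> R) :=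
  forall M : R, exists K : R, forall p : 'rV[R]_n,
    K < enorm p -> M < H p / enorm p.

(* Continuous differentiability on an open set D of a finite-dimensional
   space, where continuity of q |-> 'd f q amounts to that of all
   q |-> 'd f q v. *)
Definition C1_on (R : realType) (V W : normedModType R) (D : set V)
    (f : V -> W) :=
  forall p : V, D p ->
    differentiable f p /\
    forall v : V, {for p, continuous (fun q : V => 'd f q v : W)}.

Section HopfLax.
Context (R : realType) (n : nat).
Implicit Types (H sigma : 'rV[R]_n -> R) (t T : R) (x y z : 'rV[R]_n).

Definition fenchel H z : R := setmax [set dot z y - H y | y in setT].

Definition hopf_lax_cost H sigma t x y : R :=
  sigma y + t * fenchel H (t^-1 *: (x - y)).

Definition hopf_lax H sigma t x : R :=
  setmin [set hopf_lax_cost H sigma t x y | y in setT].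

Definition minimizers H sigma t x : set 'rV[R]_n :=
  [set y | forall z, hopf_lax_cost H sigma t x y <= hopf_lax_cost H sigma t x z].

Definition hypH0 H : Prop := strictly_convex H /\ superlinear H.

Definition hypH1 T H sigma : Prop :=
  continuous sigma /\
  forall (t0 : R) (x0 : 'rV[R]_n), 0 <= t0 -> t0 < T ->
    exists r N : R, [/\ 0 < r, 0 < N &
      forall (t : R) (x z : 'rV[R]_n), N < enorm z -> 0 < t -> t < T ->
        `|t - t0| + enorm (x - x0) < r ->
        setmin [set hopf_lax_cost H sigma t x y | y in [set y | enorm y <= N]]
          < hopf_lax_cost H sigma t x z].

End HopfLax.

(* Main.v *)
Require Import Defs.
From HB Require Import structures.
From mathcomp Require Import all_boot all_order all_algebra.
From mathcomp Require Import all_classical all_reals all_analysis.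
From mathcomp Require Import ring lra.

Set Implicit Arguments.
Unset Strict Implicit.
Unset Printing Implicit Defensive.

Import Order.TTheory GRing.Theory Num.Theory.
Import numFieldNormedType.Exports.

Local Open Scope classical_set_scope.
Local Open Scope ring_scope.

(** Write L for the conjugate of H and u(t, x) for the Hopf-Lax minimum. The proof
    has two independent halves, where ts is the time at which minimizers are
    assumed unique: they are also unique before ts, and uniqueness forces u to be
    C^1.

    Uniqueness at smaller times ([unique_minimizer_below]). Let Y(x) be the
    minimizer at (ts, x). If (t, x0) lies on the segment from (0, Y(x)) to
    (ts, x), then convexity of L shows that every minimizer at (t, x0) is also
    a minimizer at (ts, x), hence equals Y(x). So it is enough that these
    segments cover the slice at time t, that is, that
    Phi(x) = x - ((ts - t) / ts) (x - Y(x)) is onto. Now Y is continuous,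
    because unique minimizers depend continuously on parameters
    ([argmin_continuous]), and |x - Y(x)| is bounded, because sigma is Lipschitz
    and L superlinear ([cost_bound]). A continuous map at bounded distance from
    the identity is onto ([near_identity_onto]). That is a form of Brouwer's
    theorem. A topological argument replaces the inversion of characteristics
    because H may have corners, where a momentum does not determine a velocity.

    The Brouwer step is proved by a parity count on a grid ([box_sum_cup]). To
    each coordinate i attach the 0/1 function recording whether the i-th
    component of Phi exceeds the target. Its discrete differential is a 1-cochain
    mod 2, and the cup product of these n cochains is an exact n-cochain whose
    sum over the grid reduces, face by face, to 1. Hence it is nonzero on some
    small cube, and on this cube every component of Phi takes values on both
    sides of the target ([cube_all_labels]). Refining the grid and extracting a
    cluster point gives a preimage.

    Smoothness ([hopf_lax_C1]). Strict convexity of H makes the maximizer q(v)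
    of q |-> <v, q> - H q unique, hence continuous in v. Since L is a supremum of
    affine functions, t L((x - y) / t) = sup_q <q, x - y> - t H q, so moving (t, x) to
    (t', x') with y fixed changes the cost by at most
    <q, x' - x> - H(q) (t' - t), where q is the maximizer at the endpoint
    ([cost_increment]). Using this with the minimizers of both endpoints traps the
    increment of u between two such linear forms whose coefficients converge to
    the same limit, which is therefore the differential of u
    ([differentiable_squeeze]); it depends continuously on the point. *)

(** * A mod 2 cube lemma on the integer grid *)

(** Grid points are functions [nat -> nat], whatever the dimension; the list of
    active directions is carried separately. This keeps the induction on the
    dimension free of dependent types. *)
Definition upd (b : nat -> nat) (j k : nat) : nat -> nat :=
  fun i => if i == j then k else b i.
Definition step (j : nat) (b : nat -> nat) := upd b j (b j).+1.
Definition del (j : nat) (D : seq nat) := [seq x <- D | x != j].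
Definition gdiff (V : zmodType) (j : nat) (phi : (nat -> nat) -> V) b :=
  phi (step j b) - phi b.

Lemma updC b j k x y : j != k -> upd (upd b j x) k y = upd (upd b k y) j x.
Proof.
move=> jk; apply/funext => i; rewrite /upd.
by case: (eqVneq i k) => // ->; rewrite eq_sym (negPf jk).
Qed.

Lemma updd b j x y : upd (upd b j x) j y = upd b j y.
Proof. by apply/funext => i; rewrite /upd; case: eqP. Qed.

Lemma updE b j k : upd b j k j = k.
Proof. by rewrite /upd eqxx. Qed.

Lemma step_upd b j k x : j != k -> step j (upd b k x) = upd (step j b) k x.
Proof.
move=> jk; rewrite /step [X in upd _ _ X.+1]/upd (negPf jk).
by rewrite updC// eq_sym.
Qed.

Lemma gdiffC (V : zmodType) j k (phi : (nat -> nat) -> V) b :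
  gdiff k (gdiff j phi) b = gdiff j (gdiff k phi) b.
Proof.
have [->//|jk] := eqVneq j k.
have E : step j (step k b) = step k (step j b).
  rewrite {1}[step k b]/step step_upd//; congr (upd (step j b) k _.+1).
  by rewrite /step /upd eq_sym (negPf jk).
by rewrite /gdiff E !opprB addrACA [_ - phi (step j b)]addrC addrACA addrC.
Qed.

Lemma delC j k D : del j (del k D) = del k (del j D).
Proof. by rewrite /del -!filter_predI; apply: eq_filter => x /=; rewrite andbC. Qed.

Lemma del_notin j D : j \notin D -> del j D = D.
Proof.
by move=> jD; apply/all_filterP/allP => x xD; apply: contraNneq jD => <-.
Qed.

(** Swapping the two indices pairs up the summands, and each pair cancels in
    characteristic two: this is the mechanism behind [d d = 0]. *)
Lemma sum_sym_pairs (D : seq nat) (G : nat -> nat -> 'F_2) :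
  (forall j k, G j k = G k j) ->
  \sum_(k <- D) \sum_(j <- del k D) G k j = 0.
Proof.
move=> Gs.
have E k : \sum_(j <- del k D) G k j
    = \sum_(j <- D | (j < k)%N) G k j + \sum_(j <- D | (k < j)%N) G k j.
  rewrite big_filter (bigID (fun j => (j < k)%N)) /=; congr (_ + _);
    by apply: eq_bigl => j; case: (ltngtP j k).
rewrite (eq_bigr _ (fun k _ => E k)) big_split /=.
rewrite [X in _ + X](exchange_big_dep predT)//= -big_split /=.
rewrite big1// => k _.
rewrite [X in _ + X](eq_bigr (fun j => G k j)) => [|j _]; last exact: Gs.
by rewrite -mulr2n -mulr_natl pchar_Zp// mul0r.
Qed.

Section CubeSum.
Variables (N : nat) (A : nat -> (nat -> nat) -> bool).

(** The value on the cube spanned at [b] by the directions [D] of the cup product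
    of the coboundaries of [A i], for [i] in [s]. The recursive clause is the exact
    form [d (A i * (product of the rest))]; [cup_prod] recovers the
    product form. Signs disappear over 'F_2. *)
Fixpoint cup (s D : seq nat) : (nat -> nat) -> 'F_2 :=
  if s is i :: s' then
    fun b => \sum_(j <- D) gdiff j (fun c => (A i c)%:R * cup s' (del j D) c) b
  else fun _ => 1.

(** [d d = 0] for the cochain [cup s]. *)
Lemma cup_closed s D b : \sum_(k <- D) gdiff k (cup s (del k D)) b = 0.
Proof.
case: s => [|i s] /=; first by rewrite big1// => k _; rewrite /gdiff subrr.
(* the twice differentiated cochain does not depend on the order of k and j *)
set h := fun k j : nat => (fun c => (A i c)%:R * cup s (del j (del k D)) c).
rewrite -[RHS](@sum_sym_pairs D (fun k j => gdiff k (gdiff j (h k j)) b)).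
  by apply: eq_bigr => k _; rewrite /gdiff -sumrB.
by move=> j k; rewrite gdiffC /h delC.
Qed.

(** Leibniz rule: the term in which the rest of the product is differentiated
    vanishes because the rest is closed. *)
Lemma cup_prod i s D b : cup (i :: s) D b =
  \sum_(j <- D) ((A i (step j b))%:R - (A i b)%:R) * cup s (del j D) (step j b).
Proof.
rewrite /= -[RHS]addr0 -[X in _ + X](mulr0 (A i b)%:R).
rewrite -[X in _ * X](cup_closed s D b) mulr_sumr -big_split /=.
apply: eq_bigr => j _; rewrite /gdiff mulrBl mulrBr.
by rewrite addrA subrK.
Qed.

(** Each factor of the product is the variation of one label along an edge, so a
    nonzero product forces every label to vary on the cube. *)
Lemma cup_neq0 s D b : cup s D b != 0 ->
  forall i, i \in s -> exists c c' : nat -> nat,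
    [/\ forall x, (b x <= c x <= b x + (x \in D))%N,
        forall x, (b x <= c' x <= b x + (x \in D))%N & A i c != A i c'].
Proof.
elim: s D b => // i s IH D b; rewrite cup_prod => nz.
have {nz}[j jD nz] : exists2 j, j \in D &
    ((A i (step j b))%:R - (A i b)%:R) * cup s (del j D) (step j b) != 0.
  apply: contrapT => H; move/eqP: nz; apply.
  rewrite big_seq big1// => j jD; apply/eqP/negPn/negP => nz.
  by apply: H; exists j.
move: nz; rewrite mulf_eq0 negb_or => /andP[nA nz].
have sb c : (forall x, (step j b x <= c x <= step j b x + (x \in del j D))%N) ->
    forall x, (b x <= c x <= b x + (x \in D))%N.
  move=> H x; move: (H x); rewrite /step /upd mem_filter.
  case: eqP => [->|_] //=; rewrite jD addn0 addn1.
  by case/andP => /ltnW -> ->.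
move=> k; rewrite inE => /predU1P[->|ks].
  exists (step j b), b; split.
  - by apply: sb => x; rewrite leqnn leq_addr.
  - by move=> x; rewrite leqnn leq_addr.
  - by apply: contraNneq nA => ->; rewrite subrr.
have [c [c' [H1 H2 H3]]] := IH _ _ nz k ks.
by exists c, c'; split => //; exact: sb.
Qed.

Definition line_sum (j : nat) (phi : (nat -> nat) -> 'F_2) b :=
  \sum_(0 <= k < N) phi (upd b j k).
Definition box_sum D phi := foldr line_sum phi D.

Lemma line_sumC j k phi : line_sum j (line_sum k phi) = line_sum k (line_sum j phi).
Proof.
have [->//|jk] := eqVneq j k.
apply/funext => b; rewrite /line_sum exchange_big /=.
by apply: eq_bigr => x _; apply: eq_bigr => y _; rewrite updC.
Qed.

(** Summations along different lines commute, so any active direction can be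
    summed first, which is what telescoping needs. *)
Lemma box_sum_del j D phi : uniq D -> j \in D ->
  box_sum D phi = box_sum (del j D) (line_sum j phi).
Proof.
elim: D => //= x D IH /andP[xD uD]; rewrite inE => /predU1P[->|jD].
  rewrite eqxx /= -/(del x D) del_notin//.
  by elim: D {IH xD uD} => //= y D <-; rewrite line_sumC.
have -> : x != j by apply: contraNneq xD => ->.
by rewrite /= IH.
Qed.

Lemma line_sum_gdiff j phi b :
  line_sum j (gdiff j phi) b = phi (upd b j N) - phi (upd b j 0).
Proof.
rewrite /line_sum -(telescope_sumr (fun k => phi (upd b j k)))//.
by apply: eq_bigr => k _; rewrite /gdiff /step updd updE.
Qed.

Lemma box_sum_sum D (s : seq nat) (phi : nat -> (nat -> nat) -> 'F_2) b :
  box_sum D (fun c => \sum_(j <- s) phi j c) b = \sum_(j <- s) box_sum D (phi j) b.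
Proof.
elim: D b => //= x D IH b; rewrite [RHS]exchange_big /=.
by apply: eq_bigr => k _; rewrite IH.
Qed.

Lemma box_sum_upd i k D phi b : i \notin D ->
  box_sum D (fun c => phi (upd c i k)) b = box_sum D phi (upd b i k).
Proof.
elim: D b => //= x D IH b; rewrite inE negb_or => /andP[ix iD].
by apply: eq_bigr => y _; rewrite IH// updC// eq_sym.
Qed.

Lemma box_sum_neq0 D phi b : uniq D -> box_sum D phi b != 0 ->
  exists2 c, phi c != 0 & forall x, x \in D -> (c x < N)%N.
Proof.
suff H : box_sum D phi b != 0 -> exists2 c, phi c != 0 &
    forall x, if x \in D then (c x < N)%N else c x == b x.
  by move=> _ /H[c ? C]; exists c => // x xD; have := C x; rewrite xD.
elim: D b => [|j D IH] b /=; first by exists b.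
move=> nz; have [k kN nz'] : exists2 k, (k < N)%N & box_sum D phi (upd b j k) != 0.
  apply: contrapT => H; move/eqP: nz; apply; rewrite /line_sum.
  rewrite big_nat big1// => k kN.
  by apply/eqP/negPn/negP => nz; apply: H; exists k.
have [c c0 C] := IH _ nz'; exists c => // x; have := C x.
rewrite inE; case: (x \in D); first by rewrite orbT.
by rewrite orbF /upd; case: (x =P j) => // _ /eqP ->.
Qed.

(** The labels of direction [i] are prescribed on the two faces orthogonal
    to [i], for all grid points, including those outside of the box. *)
Hypothesis A0 : forall i b, b i = 0%N -> A i b = false.
Hypothesis AN : forall i b, b i = N -> A i b = true.

(** Discrete Stokes: the sum of an exact cochain reduces to the faces of the box.
    On a face orthogonal to a direction [j] of a later factor, the label [A j] is
    constant, so that factor vanishes; on the faces orthogonal to [i] the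
    label [A i] is 0 on one side and 1 on the other, which leaves the same sum in
    one dimension less. *)
Lemma box_sum_cup s b : uniq s -> box_sum s (cup s s) b = 1.
Proof.
elim: s b => //= i s IH b /andP[is_ us].
set D := i :: s; have uD : uniq D by rewrite /= is_.
rewrite -[LHS]/(box_sum D (fun c => \sum_(j <- D)
   gdiff j (fun c => (A i c)%:R * cup s (del j D) c) c) b) box_sum_sum.
have E j : j \in D -> box_sum D (gdiff j
    (fun c => (A i c)%:R * cup s (del j D) c)) b
  = box_sum (del j D) (fun c => (A i (upd c j N))%:R * cup s (del j D) (upd c j N)
     - (A i (upd c j 0))%:R * cup s (del j D) (upd c j 0)) b.
  move=> jD; rewrite (box_sum_del _ uD jD); congr (box_sum _ _ _).
  by apply/funext => c; rewrite line_sum_gdiff.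
rewrite big_seq (eq_bigr _ E) -big_seq big_cons big_seq [X in _ + X]big1 ?addr0.
  have -> : del i D = s by rewrite /del /= eqxx -/(del i s) del_notin.
  rewrite -[RHS](IH (upd b i N) us) -box_sum_upd//; congr (box_sum _ _ _).
  apply/funext => c; rewrite AN ?updE// A0 ?updE//.
  by rewrite mul0r subr0 mul1r.
move=> j js.
have Z c k : (forall c' : nat -> nat, c' j = k -> A j c' = A j (upd c j k)) ->
    cup s (del j D) (upd c j k) = 0.
  move=> H; apply/eqP/negPn/negP => nz.
  have [p [q [pH qH]]] := cup_neq0 nz js.
  suff P r : (forall x, (upd c j k x <= r x <= upd c j k x + (x \in del j D))%N) ->
     A j r = A j (upd c j k) by rewrite P// P// eqxx.
  move=> /(_ j); rewrite updE mem_filter eqxx addn0 -eqn_leq => /eqP e.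
  exact: H.
have -> : (fun c => (A i (upd c j N))%:R * cup s (del j D) (upd c j N)
     - (A i (upd c j 0))%:R * cup s (del j D) (upd c j 0)) = fun _ => 0.
  apply/funext => c; rewrite !Z ?mulr0 ?subrr//.
  - by move=> c' e; rewrite !A0 ?updE.
  - by move=> c' e; rewrite !AN ?updE.
elim: (del j D) {E} b => //= x l IHl b.
by rewrite /line_sum big1.
Qed.

(** The discrete form of the Poincare-Miranda theorem. *)
Lemma cube_all_labels n : exists c : nat -> nat,
  (forall x, (x < n)%N -> (c x < N)%N) /\
  forall i, (i < n)%N -> exists p q : nat -> nat,
    [/\ forall x, (c x <= p x <= (c x).+1)%N,
        forall x, (c x <= q x <= (c x).+1)%N, A i p & ~~ A i q].
Proof.
have us := iota_uniq 0 n.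
have [|c nz cN] := @box_sum_neq0 (iota 0 n)
    (cup (iota 0 n) (iota 0 n)) (fun _ => 0%N) us.
  by rewrite box_sum_cup// oner_eq0.
exists c; split=> [x xn|i i_n]; first by apply: cN; rewrite mem_iota.
have [|p [q [pH qH]]] := cup_neq0 nz (i := i); first by rewrite mem_iota.
have W r : (forall x, (c x <= r x <= c x + (x \in iota 0 n))%N) ->
    forall x, (c x <= r x <= (c x).+1)%N.
  move=> H x; case/andP: (H x) => -> /leq_trans; apply.
  by rewrite -addn1 leq_add2l leq_b1.
case Ap: (A i p); case Aq: (A i q) => // _.
- by exists p, q; split; rewrite ?Ap ?Aq//; exact: W.
- by exists q, p; split; rewrite ?Ap ?Aq//; exact: W.
Qed.

End CubeSum.

(** * Minimizers depending on parameters, and maps near the identity *)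

Lemma coord_le_norm (R : realType) n (x : 'rV[R]_n) i : `|x 0 i| <= `|x|.
Proof.
rewrite [leRHS]/Num.norm /= mx_normrE; apply/bigmax_geP; right.
by exists (0, i).
Qed.

Lemma rV_norm_le (R : realType) n (x : 'rV[R]_n) (e : R) : 0 <= e ->
  (forall i, `|x 0 i| <= e) -> `|x| <= e.
Proof.
move=> e0 H; rewrite [leLHS]/Num.norm /= mx_normrE; apply/bigmax_leP; split=> //.
by case=> a i _ /=; rewrite ord1.
Qed.

Lemma ball_rV_compact (R : realType) n (x : 'rV[R]_n) (r : R) :
  compact [set y | `|x - y| <= r].
Proof.
apply: bounded_closed_compact; last exact: closed_closed_ball_.
exists (r + `|x|); split; first exact: num_real.
move=> M /ltW rM y /= yr; apply: le_trans rM.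
by rewrite -[y](subrK x) -normrN opprD opprB (le_trans (ler_normD _ _))// normrN lerD2r.
Qed.

Lemma exists_argmin (R : realType) n (F : 'rV[R]_n -> R) (y0 : 'rV[R]_n) (B : R) :
  continuous F -> (forall y, F y <= F y0 -> `|y| <= B) ->
  exists y, forall z, F y <= F z.
Proof.
move=> cF HB; pose K := [set y : 'rV[R]_n | `|0 - y| <= B].
have Ky0 : K y0 by rewrite /K /= sub0r normrN; exact: HB.
have [||y _ Hy] := @EVT_min_rV R n F K (ex_intro _ y0 Ky0).
- exact: ball_rV_compact.
- exact: continuous_subspaceT.
exists y => z; have [zy0|/ltW y0z] := leP (F z) (F y0).
  by apply: Hy; rewrite inE /K /= sub0r normrN; exact: HB.
by apply: le_trans y0z; apply: Hy; rewrite inE.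
Qed.

(** Any cluster point of [m x], as [x] tends to [x0], is again a minimizer at [x0],
    hence equals [m x0]; local boundedness turns this into convergence. *)
Lemma argmin_continuous (R : realType) (X : topologicalType) n
    (F : X -> 'rV[R]_n -> R) (m : X -> 'rV[R]_n) (x0 : X) (B : R) :
  (forall y, {for (x0, y), continuous (fun p : X * 'rV[R]_n => F p.1 p.2)}) ->
  (\forall x \near x0, forall y, F x (m x) <= F x y) ->
  (\forall x \near x0, `|m x| <= B) ->
  (forall y, (forall z, F x0 y <= F x0 z) -> y = m x0) ->
  {for x0, continuous m}.
Proof.
move=> cF minm bm um.
(* a compact neighbourhood of m x0 containing the ball of radius B around 0 *)
pose K := [set y : 'rV[R]_n | `|m x0 - y| <= B + B + 1].
have mB := nbhs_singleton bm.
have B0 : 0 <= B by apply: le_trans mB.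
apply: (@compact_cluster_set1 _ (m x0) (m @ x0) K) => //.
- exact: ball_rV_compact.
- apply: filterS (nbhsx_ballx (m x0) 1 ltr01) => y.
  rewrite -ball_normE /K /= => /ltW /le_trans; apply.
  by rewrite lerDr addr_ge0.
- apply: filterS bm => x mx; rewrite /K /=.
  by have := ler_normB (m x0) (m x); lra.
apply/seteqP; split => [y /= cy|_ /= ->]; last first.
  move=> P Q PF Qx; exists (m x0); split; [exact: (nbhs_singleton PF)|exact: nbhs_singleton].
apply: um => z; rewrite leNgt; apply/negP => zy.
pose c := (F x0 z + F x0 y) / 2.
have zc : F x0 z < c by rewrite /c; lra.
have cy' : c < F x0 y by rewrite /c; lra.
have Hz : \forall x \near x0, F x z < c.
  have /(cvgr_lt _) /(_ c zc) [[U V] /= [Ux Vz] UV] := cF z.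
  by apply: filterS Ux => x Ux; apply: (UV (x, z)); split=> //; exact: nbhs_singleton.
have Hy : \forall p \near (x0, y), c < F p.1 p.2.
  by have /(cvgr_gt _) /(_ c cy') := cF y.
have [[U V] /= [Ux Vy] UV] := Hy.
have G : (m @ x0) (m @` [set x | [/\ U x, F x z < c & forall y, F x (m x) <= F x y]]).
  by apply: filterS3 Ux Hz minm => x ? ? ?; exists x.
have [_ [[x [Ux' xz mx] <-] Vm]] := cy _ _ G Vy.
have := UV (x, m x) (conj Ux' Vm); rewrite /= ltNge => /negP; apply.
exact: le_trans (mx z) (ltW xz).
Qed.

(** On a cube of half-side [c > C] around the target [z], the i-th component of
    [Phi - z] is negative on the lower i-th face and positive on the upper one, so
    [cube_all_labels] applies on every grid. Around a cluster point of the cubes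
    found on finer and finer grids each component of [Phi - z] takes values
    of both weak signs, hence vanishes there. *)
Lemma near_identity_onto (R : realType) n (Phi : 'rV[R]_n -> 'rV[R]_n) (C : R) :
  continuous Phi -> (forall x, `|Phi x - x| <= C) ->
  forall z, exists x, Phi x = z.
Proof.
move=> cPhi HC z.
have C0 : 0 <= C by apply: le_trans (HC 0).
pose c := C + 1.
pose pos (N : nat) (b : nat -> nat) : 'rV[R]_n :=
  \row_i (z 0 i - c + 2 * c * (b i)%:R / N%:R).
(* beyond the n actual coordinates any labelling with the right face values does *)
pose A N (i : nat) b : bool :=
  if insub i is Some j then z 0 j < Phi (pos N b) 0 j else b i == N.
have HC' x i : - C <= Phi x 0 i - x 0 i <= C.
  by rewrite -ler_norml (le_trans _ (HC x))//; have := coord_le_norm (Phi x - x) i; rewrite !mxE.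
have A0 N i b : b i = 0%N -> A N.+1 i b = false.
  rewrite /A => bi; case: insubP => [j _ ji|_]; last by rewrite bi.
  have := HC' (pos N.+1 b) j; rewrite [pos _ _ 0 j]mxE ji bi mulr0 mul0r /c.
  by move=> ?; apply/negbTE; rewrite -leNgt; lra.
have AN N i b : b i = N.+1 -> A N.+1 i b = true.
  rewrite /A => bi; case: insubP => [j _ ji|_]; last by rewrite bi eqxx.
  have := HC' (pos N.+1 b) j; rewrite [pos _ _ 0 j]mxE ji bi mulfK ?pnatr_eq0// /c.
  by move=> ?; lra.
have [a aP] := boolp.choice (fun N => cube_all_labels (A0 N) (AN N) n).
pose x_ N := pos N.+1 (a N).
have c0 : 0 < c by rewrite /c; lra.
have xK N : `|z - x_ N| <= c.
  apply: rV_norm_le => [|i]; first exact: ltW.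
  rewrite !mxE ler_norml.
  have := (aP N).1 i (ltn_ord i).
  have : 0 <= 2 * c * (a N i)%:R / N.+1%:R.
    by rewrite divr_ge0// mulr_ge0// mulr_ge0// ltW.
  move=> H1 H2; have : 2 * c * (a N i)%:R / N.+1%:R <= 2 * c.
    by rewrite ler_pdivrMr ?ltr0n// ler_wpM2l ?ler_nat 1?ltnW// mulr_ge0// ltW.
  by move: H1; move: (2 * c * _ / _) => w ? ?; apply/andP; split; lra.
have close N p : (forall x, (a N x <= p x <= (a N x).+1)%N) ->
    `|x_ N - pos N.+1 p| <= 2 * c / N.+1%:R.
  move=> H; have e0 : 0 <= 2 * c / N.+1%:R by rewrite divr_ge0// mulr_ge0// ltW.
  apply: rV_norm_le => // i; rewrite !mxE.
  have /andP[h1 h2] := H i.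
  have -> : z 0 i - c + 2 * c * (a N i)%:R / N.+1%:R
     - (z 0 i - c + 2 * c * (p i)%:R / N.+1%:R)
     = 2 * c / N.+1%:R * ((a N i)%:R - (p i)%:R) by ring.
  rewrite normrM ger0_norm// ler_piMr// distrC ger0_norm ?subr_ge0 ?ler_nat//.
  by rewrite lerBlDl natr1 ler_nat.
have [x [_ xcl]] : [set y | `|z - y| <= c] `&` cluster (x_ @ \oo) !=set0.
  by apply: ball_rV_compact; exists 0%N => // N _; exact: xK.
have small e : 0 < e -> \forall N \near \oo, 2 * c / N.+1%:R < e.
  move=> e0; near=> N; rewrite ltr_pdivrMr ?ltr0n// -ltr_pdivrMl//.
  apply: (@lt_trans _ _ N%:R); last by rewrite ltr_nat.
  by near: N; exact: nbhs_infty_gtr.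
(* grid points of the selected cubes cannot avoid an open set of values *)
have key (i : 'I_n) (P : set R) (w : nat -> nat -> nat) :
    (forall N x, (a N x <= w N x <= (a N x).+1)%N) ->
    (forall N, ~ P (Phi (pos N.+1 (w N)) 0 i)) -> ~ nbhs (Phi x 0 i) P.
  move=> wa nP PH.
  have : \forall y \near x, P (Phi y 0 i).
    have : (fun y => Phi y 0 i) @ x --> Phi x 0 i.
      apply: (@cvg_comp _ _ _ Phi (fun M => M 0 i) _ (nbhs (Phi x))).
        exact: cPhi.
      exact: coord_continuous.
    exact.
  move=> /nbhs_ballP[e /= e0 He].
  have e2 : 0 < e / 2 by rewrite divr_gt0.
  have G : (x_ @ \oo) (x_ @` [set N | 2 * c / N.+1%:R < e / 2]).
    by apply: filterS (small _ e2) => N ?; exists N.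
  have [_ [[N /= Ne <-]]] := xcl _ _ G (nbhsx_ballx x _ e2).
  rewrite -ball_normE /= => xN.
  apply: (nP N); apply: He; rewrite -ball_normE /=.
  have := le_lt_trans (close N _ (wa N)) Ne.
  have := ler_normD (x - x_ N) (x_ N - pos N.+1 (w N)).
  by rewrite subrKA; lra.
exists x; apply/rowP => i.
have wP N : exists w : (nat -> nat) * (nat -> nat),
   [/\ forall x, (a N x <= w.1 x <= (a N x).+1)%N,
       forall x, (a N x <= w.2 x <= (a N x).+1)%N,
       z 0 i < Phi (pos N.+1 w.1) 0 i & ~~ (z 0 i < Phi (pos N.+1 w.2) 0 i)].
  have [p [q [H1 H2 H3 H4]]] := (aP N).2 i (ltn_ord i).
  exists (p, q); move: H3 H4; rewrite /A; case: insubP => [j _ /val_inj ->//|].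
  by rewrite ltn_ord.
have {wP}[w wP] := boolp.choice wP.
have [lt|gt|//] := ltgtP (Phi x 0 i) (z 0 i).
- exfalso; apply: (key i [set r | r < z 0 i] (fun N => (w N).1)).
  + by move=> N; case: (wP N).
  + by move=> N /=; case: (wP N) => _ _ h _; apply/negP; rewrite -leNgt ltW.
  + exact: (lt_nbhsl lt).
- exfalso; apply: (key i [set r | z 0 i < r] (fun N => (w N).2)).
  + by move=> N; case: (wP N).
  + by move=> N /=; case: (wP N) => _ _ _ /negP.
  + exact: (lt_nbhsr gt).
Unshelve. all: by end_near. Qed.

(** * Convex functions on row vectors are continuous *)

Lemma continuous_pair (X Y Z : topologicalType) (f : X -> Y) (g : X -> Z) x :
  {for x, continuous f} -> {for x, continuous g} ->
  {for x, continuous (fun w => (f w, g w))}.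
Proof.
by move=> cf cg; exact: (@cvg_pair X Y Z (nbhs x) (nbhs (f x)) (nbhs (g x))).
Qed.

Lemma dotZl (R : realType) n a (x y : 'rV[R]_n) : dot (a *: x) y = a * dot x y.
Proof. by rewrite /dot mulr_sumr; apply: eq_bigr => i _; rewrite !mxE mulrA. Qed.
Lemma dotZr (R : realType) n a (x y : 'rV[R]_n) : dot x (a *: y) = a * dot x y.
Proof. by rewrite /dot mulr_sumr; apply: eq_bigr => i _; rewrite !mxE mulrCA. Qed.
Lemma dotDl (R : realType) n (x y z : 'rV[R]_n) : dot (x + y) z = dot x z + dot y z.
Proof. by rewrite /dot -big_split; apply: eq_bigr => i _; rewrite !mxE mulrDl. Qed.
Lemma dotDr (R : realType) n (x y z : 'rV[R]_n) : dot x (y + z) = dot x y + dot x z.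
Proof. by rewrite /dot -big_split; apply: eq_bigr => i _; rewrite !mxE mulrDr. Qed.
Lemma dotNl (R : realType) n (x y : 'rV[R]_n) : dot (- x) y = - dot x y.
Proof. by rewrite -scaleN1r dotZl mulN1r. Qed.
Lemma dot0r (R : realType) n (x : 'rV[R]_n) : dot x 0 = 0.
Proof. by rewrite -(scale0r 0) dotZr mul0r. Qed.

Lemma dot_le_norm (R : realType) n (x y : 'rV[R]_n) :
  `|dot x y| <= n%:R * `|x| * `|y|.
Proof.
apply: le_trans (ler_norm_sum _ _ _) _.
apply: (@le_trans _ _ (\sum_(i < n) `|x| * `|y|)); last first.
  by rewrite sumr_const card_ord -[leLHS]mulr_natl mulrA.
by apply: ler_sum => i _; rewrite normrM ler_pM// coord_le_norm.
Qed.

Lemma norm_le_enorm (R : realType) n (x : 'rV[R]_n) : `|x| <= enorm x.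
Proof.
apply: rV_norm_le => [|i]; first exact: sqrtr_ge0.
rewrite -sqrtr_sqr /enorm ler_wsqrtr// /dot (bigD1 i)//= expr2 lerDl.
by apply: sumr_ge0 => j _; rewrite -expr2 sqr_ge0.
Qed.

Lemma continuous_dot (R : realType) n (X : topologicalType) (f g : X -> 'rV[R]_n) x :
  {for x, continuous f} -> {for x, continuous g} ->
  {for x, continuous (fun w => dot (f w) (g w))}.
Proof.
move=> cf cg; apply: (@cvg_big _ _ _ _ _ _ _ _ _ (fun i w => f w 0 i * g w 0 i)).
  exact: add_continuous.
have coord (h : X -> 'rV[R]_n) i : {for x, continuous h} ->
    {for x, continuous (fun w => h w 0 i)}.
  move=> ch; apply: (@continuous_comp _ _ _ h (fun M : 'rV[R]_n => M 0 i)) => //.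
  exact: coord_continuous.
by move=> i _; apply: continuousM; exact: coord.
Qed.

Definition convex_fun (R : realType) n (f : 'rV[R]_n -> R) :=
  forall (p q : 'rV[R]_n) (a : R), 0 <= a -> a <= 1 ->
    f (a *: p + (1 - a) *: q) <= a * f p + (1 - a) * f q.

Lemma strictly_convexW (R : realType) n (f : 'rV[R]_n -> R) :
  strictly_convex f -> convex_fun f.
Proof.
move=> sf p q a a0 a1; have [->|pq] := eqVneq p q.
  by rewrite -scalerDl subrKC scale1r -mulrDl subrKC mul1r.
move: a0; rewrite le_eqVlt => /predU1P[<-|a0].
  by rewrite subr0 scale0r scale1r mul0r mul1r !add0r.
move: a1; rewrite le_eqVlt => /predU1P[->|a1].
  by rewrite subrr scale0r scale1r mul0r mul1r !addr0.
exact/ltW/sf.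
Qed.

Lemma half_double (R : realType) n (x : 'rV[R]_n) : 2^-1 *: (x + x) = x.
Proof.
by rewrite scalerDr -scalerDl (_ : 2^-1 + 2^-1 = 1 :> R) ?scale1r//; lra.
Qed.

Lemma convex_half (R : realType) n (f : 'rV[R]_n -> R) (p q : 'rV[R]_n) :
  convex_fun f -> f (2^-1 *: (p + q)) <= (f p + f q) / 2.
Proof.
move=> cf; have -> : 2^-1 *: (p + q) = 2^-1 *: p + (1 - 2^-1) *: q.
  by rewrite scalerDr; congr (_ + _ *: _); lra.
have -> : (f p + f q) / 2 = 2^-1 * f p + (1 - 2^-1) * f q by lra.
by apply: cf; lra.
Qed.

Lemma convex_line_ub (R : realType) n (f : 'rV[R]_n -> R) (x e : 'rV[R]_n) :
  convex_fun f -> exists2 M, 0 <= M &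
    forall t, `|t| <= 1 -> f (x + t *: e) - f x <= M * `|t|.
Proof.
move=> cf; pose M := `|f (x + e) - f x| + `|f (x - e) - f x|.
have pos (e' : 'rV[R]_n) t : 0 <= t -> t <= 1 ->
    f (x + t *: e') - f x <= `|f (x + e') - f x| * t.
  move=> t0 t1; have := cf (x + e') x t t0 t1.
  have -> : t *: (x + e') + (1 - t) *: x = x + t *: e'.
    by rewrite scalerDr scalerBl scale1r addrC addrA subrK.
  have : (f (x + e') - f x) * t <= `|f (x + e') - f x| * t.
    by rewrite ler_wpM2r// ler_norm.
  by nra.
exists M => [|t t1]; first by rewrite addr_ge0.
have [t0|/ltW t0] := leP 0 t.
  apply: le_trans (pos e t t0 _) _; first by rewrite -(ger0_norm t0).
  by rewrite (ger0_norm t0) ler_wpM2r// lerDl.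
have := pos (- e) (- t); rewrite scalerN scaleNr opprK oppr_ge0 t0.
rewrite -(ler0_norm t0) => /(_ isT t1) /le_trans; apply.
by rewrite ler_wpM2r// lerDr.
Qed.

(** An upper bound of order [|d|] suffices: midpoint convexity between [x + d] and
    [x - d] turns it into a lower bound. The upper bound follows by adding the
    coordinates of [d] one at a time, again through midpoints, from the
    one-dimensional bound [convex_line_ub]; the radius is halved at each step. *)
Lemma convex_locally_lipschitz (R : realType) n (f : 'rV[R]_n -> R) (x : 'rV[R]_n) :
  convex_fun f -> exists C dl, [/\ 0 <= C, 0 < dl &
    forall d : 'rV[R]_n, `|d| <= dl -> `|f (x + d) - f x| <= C * `|d|].
Proof.
move=> cf.
suff [C [dl [C0 dl0 H]]] : exists C dl, [/\ 0 <= C, 0 < dl &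
    forall d : 'rV[R]_n, `|d| <= dl -> f (x + d) - f x <= C * `|d|].
  exists C, dl; split=> // d dd.
  have := H d dd; have := H (- d); rewrite normrN => /(_ dd).
  have := convex_half (x + d) (x - d) cf.
  have -> : 2^-1 *: (x + d + (x - d)) = x.
    by rewrite addrACA subrr addr0 half_double.
  move=> h1 h2 h3; rewrite ler_norml; apply/andP; split; lra.
have basis (d : 'rV[R]_n) : d = \sum_(i <- enum 'I_n) d 0 i *: delta_mx 0 i.
  by rewrite big_enum -row_sum_delta.
suff [C [dl [C0 dl0 H]]] : exists C dl, [/\ 0 <= C, 0 < dl &
    forall d : 'rV[R]_n, `|d| <= dl ->
      f (x + \sum_(i <- enum 'I_n) d 0 i *: delta_mx 0 i) - f x <= C * `|d|].
  by exists C, dl; split=> // d dd; rewrite {1}[d]basis; exact: H.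
elim: (enum 'I_n) => [|i s [C [dl [C0 dl0 H]]]].
  exists 0, 1; split=> // d _.
  by rewrite big_nil addr0 subrr mul0r.
have [M M0 HM] := convex_line_ub x (delta_mx 0 i) cf.
exists (C + M), (Num.min (dl / 2) 2^-1); split.
- exact: addr_ge0.
- by rewrite lt_min; apply/andP; split; lra.
move=> d; rewrite le_min => /andP[d1 d2].
have n2 : `|2 *: d| = 2 * `|d| by rewrite normrZ ger0_norm.
have := H (2 *: d); rewrite n2 => H1.
have {}H1 := H1 ltac:(lra).
have di := coord_le_norm d i.
have := HM (2 * d 0 i); rewrite normrM ger0_norm// => H2.
have {}H2 := H2 ltac:(lra).
have := convex_half (x + \sum_(j <- s) (2 *: d) 0 j *: delta_mx 0 j)
  (x + (2 * d 0 i) *: delta_mx 0 i) cf.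
have -> : 2^-1 *: (x + \sum_(j <- s) (2 *: d) 0 j *: delta_mx 0 j +
  (x + (2 * d 0 i) *: delta_mx 0 i)) = x + \sum_(j <- i :: s) d 0 j *: delta_mx 0 j.
  rewrite big_cons addrACA scalerDr half_double.
  congr (_ + _); rewrite addrC scalerDr scalerA mulrA mulVf// mul1r; congr (_ + _).
  rewrite scaler_sumr; apply: eq_bigr => j _.
  by rewrite mxE scalerA mulrA mulVf// mul1r.
have : M * `|d 0 i| <= M * `|d| by rewrite ler_wpM2l.
by nra.
Qed.

Lemma convex_continuous (R : realType) n (f : 'rV[R]_n -> R) :
  convex_fun f -> continuous f.
Proof.
move=> cf x; have [C [dl [C0 dl0 H]]] := convex_locally_lipschitz x cf.
apply/(@cvgrPdist_le _ _ _ (nbhs x)) => e e0.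
have eC : 0 < e / (C + 1) by rewrite divr_gt0//; lra.
have near_x r : 0 < r -> \forall y \near x, `|y - x| <= r.
  move=> r0; apply: filterS (nbhsx_ballx x r r0) => y.
  by rewrite -ball_normE /= distrC => /ltW.
apply: filterS2 (near_x _ dl0) (near_x _ eC) => y yd ye.
rewrite distrC -{1}[y](subrK x) [y - x + x]addrC.
apply: le_trans (H _ yd) _.
apply: (@le_trans _ _ (C * (e / (C + 1)))); first by rewrite ler_wpM2l.
rewrite mulrCA ler_piMr//; first exact: ltW.
by rewrite ler_pdivrMr ?mul1r; lra.
Qed.

(** * The Fenchel conjugate of a strictly convex superlinear function *)

Section Conjugate.
Variables (R : realType) (n : nat) (H : 'rV[R]_n -> R).
Hypothesis H0 : hypH0 H.

Lemma hypH0_continuous : continuous H.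
Proof. exact/convex_continuous/strictly_convexW/H0.1. Qed.

Lemma superlinear_gt M : exists2 K, 0 <= K &
  forall p, K < enorm p -> M * enorm p < H p.
Proof.
have [K HK] := H0.2 M; exists (Num.max K 0) => [|p].
  by rewrite le_max lexx orbT.
by rewrite gt_max => /andP[Kp p0]; rewrite -ltr_pdivlMr// HK.
Qed.

(** The bound is uniform for [z] in bounded sets: this is the local boundedness
    needed for the continuity of the maximizer. *)
Lemma sublevel_bounded A : exists2 B, 0 <= B & forall z y : 'rV[R]_n,
  n%:R * `|z| <= A -> H y - dot z y <= H 0 -> `|y| <= B.
Proof.
have [K K0 HK] := superlinear_gt (A + 1).
exists (K + `|H 0|) => [|z y zA yz]; first by rewrite addr_ge0.
have [yK|Ky] := leP (enorm y) K.
  by rewrite (le_trans (norm_le_enorm y))// (le_trans yK)// lerDl.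
have ye := norm_le_enorm y.
have zy : dot z y <= A * enorm y.
  rewrite (le_trans (ler_norm _))// (le_trans (dot_le_norm z y))//.
  by rewrite ler_pM// mulr_ge0.
have := HK y Ky; have := ler_norm (H 0); lra.
Qed.

Definition is_fenchel_argmax z q := forall y, dot z y - H y <= dot z q - H q.

Lemma is_fenchel_argmax_exists z : exists q, is_fenchel_argmax z q.
Proof.
have [B _ HB] := sublevel_bounded (n%:R * `|z|).
have [|y|q Hq] := @exists_argmin R n (fun y => H y - dot z y) 0 B.
- move=> y; apply: continuousB; first exact: hypH0_continuous.
  by apply: continuous_dot; [exact: cst_continuous|exact: cvg_id].
- by rewrite dot0r subr0; exact: HB.
by exists q => y; have := Hq y; lra.
Qed.

Lemma is_fenchel_argmax_unique z p q : is_fenchel_argmax z p -> is_fenchel_argmax z q -> p = q.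
Proof.
move=> Hp Hq; apply/eqP/negPn/negP => pq.
have := H0.1 p q 2^-1 pq; have -> : 1 - 2^-1 = 2^-1 :> R by lra.
have := Hp (2^-1 *: p + 2^-1 *: q); rewrite dotDr !dotZr.
have := Hq p; have := Hp q.
move=> h1 h2 h3 /(_ ltac:(lra) ltac:(lra)); lra.
Qed.

Definition fenchel_argmax z := xget 0 [set q | is_fenchel_argmax z q].

Lemma fenchel_argmaxP z : is_fenchel_argmax z (fenchel_argmax z).
Proof. by have [q] := is_fenchel_argmax_exists z; exact: xgetI. Qed.

Lemma fenchelE z : fenchel H z = dot z (fenchel_argmax z) - H (fenchel_argmax z).
Proof.
apply: setmaxE; first by exists (fenchel_argmax z).
by move=> _ [y _ <-]; exact: fenchel_argmaxP.
Qed.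

Lemma fenchel_ge z q : dot z q - H q <= fenchel H z.
Proof. by rewrite fenchelE; exact: fenchel_argmaxP. Qed.

Lemma fenchel_argmax_continuous : continuous fenchel_argmax.
Proof.
move=> z0; have [B B0 HB] := sublevel_bounded (n%:R * (`|z0| + 1)).
apply: (@argmin_continuous R _ n (fun z y => H y - dot z y) fenchel_argmax z0 B).
- move=> y; apply: continuousB.
    apply: (@continuous_comp _ _ _ snd H); first exact: cvg_snd.
    exact: hypH0_continuous.
  by apply: continuous_dot; [exact: cvg_fst|exact: cvg_snd].
- by apply: (@nearW _ (nbhs z0)) => z y; have := fenchel_argmaxP z y; lra.
- apply: filterS (nbhsx_ballx z0 1 ltr01) => z; rewrite -ball_normE /= => zz.
  apply: (HB z); last by have := fenchel_argmaxP z 0; rewrite dot0r; lra.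
  rewrite ler_wpM2l//; have := ler_normB z0 (z0 - z).
  by rewrite opprB addrC subrK; lra.
- move=> y Hy; apply: (@is_fenchel_argmax_unique z0); last exact: fenchel_argmaxP.
  by move=> w; have := Hy w; lra.
Qed.

Lemma fenchel_continuous : continuous (fenchel H).
Proof.
move=> z; rewrite (_ : fenchel H = fun z => dot z (fenchel_argmax z) - H (fenchel_argmax z)); last first.
  by apply/funext => w; exact: fenchelE.
apply: (@continuousB _ _ _ (fun w => dot w (fenchel_argmax w)) (H \o fenchel_argmax)).
  by apply: continuous_dot; [exact: cvg_id|exact: fenchel_argmax_continuous].
apply: (@continuous_comp _ _ _ fenchel_argmax H); first exact: fenchel_argmax_continuous.
exact: hypH0_continuous.
Qed.

Lemma fenchel_convex : convex_fun (fenchel H).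
Proof.
move=> p q a a0 a1; rewrite fenchelE dotDl !dotZl.
set w := fenchel_argmax _; have := fenchel_ge p w; have := fenchel_ge q w; nra.
Qed.

(** Testing the supremum at the points [+- M e_i] only already gives linear growth
    of slope [M] for the sup norm. *)
Lemma fenchel_coercive M : 0 < M -> exists2 C, 0 <= C &
  forall v, M * `|v| - C <= fenchel H v.
Proof.
move=> M0; pose C i := `|H (M *: delta_mx 0 i)| + `|H (- M *: delta_mx 0 i)|.
have C0 i : 0 <= C i by exact: addr_ge0.
exists (`|H 0| + \sum_(i < n) C i) => [|v].
  by rewrite addr_ge0// sumr_ge0.
have dotd i : dot v (delta_mx 0 i) = v 0 i.
  rewrite /dot (bigD1 i)//= big1 ?addr0 => [|j ji]; first by rewrite mxE !eqxx mulr1.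
  by rewrite mxE (negPf ji) andbF mulr0.
rewrite lerBlDr -ler_pdivlMl// mulrC.
have S0 : 0 <= \sum_(i < n) C i by rewrite sumr_ge0.
have L0 := fenchel_ge v 0; rewrite dot0r in L0.
have h0 := ler_norm (H 0).
apply: rV_norm_le => [|i]; first by rewrite divr_ge0 ?(ltW M0)//; lra.
rewrite ler_pdivlMr//.
have Ci : C i <= \sum_(i < n) C i by rewrite (bigD1 i)//= lerDl sumr_ge0.
have := fenchel_ge v (M *: delta_mx 0 i); have := fenchel_ge v (- M *: delta_mx 0 i).
rewrite !dotZr dotd.
have := ler_norm (H (M *: delta_mx 0 i)); have := ler_norm (H (- M *: delta_mx 0 i)).
move: Ci (normr_ge0 (H 0)); rewrite {1}/C.
have := normr_ge0 (H (M *: delta_mx 0 i)); have := normr_ge0 (H (- M *: delta_mx 0 i)).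
by case: (ger0P (v 0 i)); lra.
Qed.

End Conjugate.

(** * Minimizers in the Hopf-Lax formula *)

Lemma lipschitz_bound (R : realType) n (f : 'rV[R]_n -> R) :
  [lipschitz f x | x in [set: 'rV[R]_n]] ->
  exists2 k, 0 <= k & forall x y, `|f x - f y| <= k * `|x - y|.
Proof.
move=> [M [_ HM]]; exists (Num.max (M + 1) 0).
  by rewrite le_max lexx orbT.
move=> x y; apply: (HM _ _ (x, y)) => //=.
by rewrite lt_max ltrDl ltr01.
Qed.

Section HopfLaxTheory.
Variables (R : realType) (n : nat) (H sigma : 'rV[R]_n -> R).
Hypothesis H0 : hypH0 H.
Hypothesis sigma_cont : continuous sigma.
Hypothesis sigma_lip : [lipschitz sigma x | x in [set: 'rV[R]_n]].

Notation cost := (hopf_lax_cost H sigma).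
Notation L := (fenchel H).

(** Compare [y] with [x]: the gain is at most [k |x - y|], while [L] grows with slope
    [k + 1]. *)
Lemma cost_bound : exists2 B, 0 <= B & forall t x y, 0 < t ->
  cost t x y <= cost t x x -> `|x - y| <= t * B.
Proof.
have [k k0 Hk] := lipschitz_bound sigma_lip.
have [C C0 HC] := fenchel_coercive H0 (ltr_wpDl k0 ltr01).
exists (C + `|L 0|) => [|t x y t0]; first exact: addr_ge0.
rewrite /hopf_lax_cost subrr scaler0.
have := Hk x y; set v := t^-1 *: (x - y).
have -> : x - y = t *: v by rewrite /v scalerA divff ?scale1r// gt_eqF.
rewrite normrZ (gtr0_norm t0) ler_norml => /andP[h1 h2] h3.
rewrite ler_pM2l//; have := HC v; have := ler_norm (L 0) => h4 h5.
have : t * ((k + 1) * `|v| - C) <= t * L v by rewrite ler_pM2l.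
have : t * L 0 <= t * `|L 0| by rewrite ler_pM2l.
move=> h6 h7; rewrite -(ler_pM2l t0); lra.
Qed.

Lemma cost_continuous t x y : 0 < t ->
  {for ((t, x), y), continuous (fun p : (R * 'rV[R]_n) * 'rV[R]_n => cost p.1.1 p.1.2 p.2)}.
Proof.
move=> t0; set p0 := ((t, x), y); set X := ((R * 'rV[R]_n) * 'rV[R]_n)%type.
have c1 : {for p0, continuous (fun p : X => p.1.1)}.
  by apply: (@continuous_comp _ _ _ fst fst); exact: cvg_fst.
have c2 : {for p0, continuous (fun p : X => p.1.2)}.
  by apply: (@continuous_comp _ _ _ fst snd); [exact: cvg_fst|exact: cvg_snd].
have c3 : {for p0, continuous (fun p : X => p.2)} by exact: cvg_snd.
apply: (@continuousD _ _ _ (fun p : X => sigma p.2)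
   (fun p : X => p.1.1 * L (p.1.1^-1 *: (p.1.2 - p.2)))).
  apply: (@continuous_comp _ _ _ (fun p : X => p.2) sigma) => //.
  exact: sigma_cont.
apply: continuousM => //.
apply: (@continuous_comp _ _ _ (fun p : X => p.1.1^-1 *: (p.1.2 - p.2)) L).
  apply: continuousZ; first by apply: continuousV => //=; rewrite gt_eqF.
  exact: (@continuousB _ _ _ (fun p : X => p.1.2) (fun p : X => p.2)).
exact: fenchel_continuous.
Qed.

Lemma minimizer_exists t x : 0 < t -> exists y, minimizers H sigma t x y.
Proof.
move=> t0; have [B B0 HB] := cost_bound.
apply: (@exists_argmin R n (cost t x) x (`|x| + t * B)).
- move=> y; apply: (@continuous_comp _ _ _ (fun y => ((t, x), y))
    (fun p : (R * 'rV[R]_n) * 'rV[R]_n => cost p.1.1 p.1.2 p.2)).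
    by apply: continuous_pair; [exact: cst_continuous|exact: cvg_id].
  exact: cost_continuous.
- move=> y /(HB _ _ _ t0) xy; have := ler_normB x (x - y).
  by rewrite opprB addrC subrK; lra.
Qed.

Lemma hopf_laxE t x y : minimizers H sigma t x y -> hopf_lax H sigma t x = cost t x y.
Proof.
move=> my; apply: setminE; first by exists y.
by move=> _ [z _ <-]; exact: my.
Qed.

(** A minimizer at an interior point of a minimizing segment is a minimizer at its
    end, by convexity of [L]; and the segments cover, by [near_identity_onto]. *)
Lemma unique_minimizer_below ts t x0 :
  (forall x, exists y, minimizers H sigma ts x = [set y]) ->
  0 < t -> t < ts -> exists y, forall z, minimizers H sigma t x0 z -> z = y.
Proof.
move=> /boolp.choice[Y HY] t0 tts; have ts0 := lt_trans t0 tts.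
have mY x : minimizers H sigma ts x (Y x) by rewrite HY.
have uY x y : minimizers H sigma ts x y -> y = Y x by rewrite HY.
have [B B0 HB] := cost_bound.
have cY : continuous Y.
  move=> x; apply: (@argmin_continuous R _ n (cost ts) Y x (`|x| + 1 + ts * B)).
  - move=> y; apply: (@continuous_comp _ _ _ (fun p : 'rV[R]_n * 'rV[R]_n => ((ts, p.1), p.2))
      (fun p : (R * 'rV[R]_n) * 'rV[R]_n => cost p.1.1 p.1.2 p.2)).
      apply: continuous_pair; last exact: cvg_snd.
      by apply: continuous_pair; [exact: cst_continuous|exact: cvg_fst].
    exact: cost_continuous.
  - by apply: (@nearW _ (nbhs x)) => z y; exact: mY.
  - apply: filterS (nbhsx_ballx x 1 ltr01) => z; rewrite -ball_normE /= => xz.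
    have := HB _ _ _ ts0 (mY z z).
    have := ler_normB z (z - Y z); rewrite opprB [_ + (Y z - z)]addrC subrK.
    have := ler_normB x (x - z); rewrite opprB [_ + (z - x)]addrC subrK; lra.
  - exact: uY.
pose r := (ts - t) / ts.
have r0 : 0 <= r by rewrite divr_ge0 ?subr_ge0 ?ltW.
(* the segment from (0, Y x) to (ts, x) that passes through (t, x0) *)
have [x Hx] : exists x, x - r *: (x - Y x) = x0.
  apply: (@near_identity_onto R n (fun x => x - r *: (x - Y x)) (r * (ts * B))).
  - move=> x; apply: (@continuousB _ _ _ id (fun x => r *: (x - Y x))); first exact: cvg_id.
    apply: continuousZ; first exact: cst_continuous.
    by apply: (@continuousB _ _ _ id Y); [exact: cvg_id|exact: cY].
  - move=> x; rewrite addrAC subrr sub0r normrN normrZ ger0_norm//.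
    by rewrite ler_wpM2l//; exact: HB _ _ _ ts0 (mY x x).
exists (Y x) => z mz; apply: uY => w; apply: le_trans (mY x w).
have := mz (Y x); rewrite /hopf_lax_cost.
set v := ts^-1 *: (x - Y x).
have xY : x - Y x = ts *: v by rewrite scalerA divff ?scale1r// gt_eqF.
have xx0 : x - x0 = (ts - t) *: v.
  by rewrite -Hx opprB addrC subrK scalerA /r xY scalerA divfK// gt_eqF.
have -> : t^-1 *: (x0 - Y x) = v.
  have -> : x0 - Y x = t *: v.
    rewrite -[x0](subrK x) -[x0 - x]opprB xx0 -addrA xY -scaleNr -scalerDl.
    by congr (_ *: _); lra.
  by rewrite scalerA mulVf ?scale1r// gt_eqF.
set w' := t^-1 *: (x0 - z).
have -> : ts^-1 *: (x - z) = (t / ts) *: w' + (1 - t / ts) *: v.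
  have -> : x - z = t *: w' + (ts - t) *: v.
    by rewrite -xx0 scalerA divff ?scale1r ?gt_eqF// [RHS]addrC addrA subrK.
  rewrite scalerDr (scalerA _ t) (scalerA _ (ts - t)).
  congr (_ *: _ + _ *: _); first exact: mulrC.
  by rewrite mulrBr mulVf ?gt_eqF// mulrC.
have a0 : 0 <= t / ts by rewrite divr_ge0// ltW.
have a1 : t / ts <= 1 by rewrite ler_pdivrMr// mul1r ltW.
have := fenchel_convex H0 w' v a0 a1; rewrite -(ler_pM2l ts0).
have -> : ts * (t / ts * L w' + (1 - t / ts) * L v) = t * L w' + (ts - t) * L v.
  by field; rewrite gt_eqF.
lra.
Qed.

(** The function [(t, x) |-> t L((x - y) / t)] is a supremum of linear functions of
    [(t, x - y)], and [q] realizes it at [(t', x')]. *)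
Lemma cost_increment t x t' x' y q : 0 < t -> 0 < t' ->
  q = fenchel_argmax H (t'^-1 *: (x' - y)) ->
  cost t' x' y - cost t x y <= dot q (x' - x) - H q * (t' - t).
Proof.
move=> t0 t'0 qE; rewrite /hopf_lax_cost.
have -> : t' * L (t'^-1 *: (x' - y)) = dot (x' - y) q - t' * H q.
  by rewrite fenchelE// -qE dotZl mulrBr mulrA divff ?mul1r// gt_eqF.
have : t * (dot (t^-1 *: (x - y)) q - H q) <= t * L (t^-1 *: (x - y)).
  by rewrite ler_pM2l//; exact: fenchel_ge.
rewrite dotZl mulrBr mulrA divff ?mul1r ?gt_eqF//.
have -> : dot q (x' - x) = dot (x' - y) q - dot (x - y) q.
  rewrite -dotNl -dotDl opprB addrA subrK /dot.
  by apply: eq_bigr => i _; rewrite mulrC.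
lra.
Qed.

End HopfLaxTheory.

(** * Differentiability of the Hopf-Lax function *)

(** The differential of a solution of [u_t + H(D u) = 0] with momentum [q] and
    [h = H q]. *)
Definition jet (R : realType) n (q : 'rV[R]_n) (h : R) (d : R * 'rV[R]_n) : R :=
  dot q d.2 - h * d.1.

Lemma jet_linear (R : realType) n (q : 'rV[R]_n) (h : R) : linear (jet q h).
Proof.
move=> a [t x] [s y]; rewrite /jet /= dotDr dotZr scalerBr.
by rewrite -/(a *: t) mulrDr opprD addrACA; congr (_ - _ + _); rewrite /GRing.scale /= mulrCA.
Qed.

HB.instance Definition _ (R : realType) n (q : 'rV[R]_n) (h : R) :=
  GRing.isLinear.Build R (R * 'rV[R]_n)%type R _ (jet q h) (jet_linear q h).

Lemma jetB (R : realType) n (q q' : 'rV[R]_n) (h h' : R) d :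
  jet q h d - jet q' h' d = jet (q - q') (h - h') d.
Proof. by rewrite /jet dotDl dotNl; ring. Qed.

Lemma jet_le (R : realType) n (q : 'rV[R]_n) (h : R) d :
  `|jet q h d| <= (n%:R * `|q| + `|h|) * `|d|.
Proof.
rewrite /jet (le_trans (ler_normB _ _))// mulrDl lerD//.
  rewrite (le_trans (dot_le_norm _ _))// ler_wpM2l ?mulr_ge0//.
  by rewrite [leRHS]/Num.norm /= le_max lexx orbT.
by rewrite normrM ler_wpM2l// [leRHS]/Num.norm /= le_max lexx.
Qed.

Lemma jet_continuous (R : realType) n (q : 'rV[R]_n) (h : R) : continuous (jet q h).
Proof.
move=> d; apply: (@continuousB _ _ _ (fun d : R * 'rV[R]_n => dot q d.2) (fun d => h * d.1)).
  by apply: continuous_dot; [exact: cst_continuous|exact: cvg_snd].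
by apply: continuousM; [exact: cst_continuous|exact: cvg_fst].
Qed.

(** The increments of [f] lie between two linear forms whose coefficients are
    continuous in the endpoint and agree at [p], so the error is [o(p' - p)]. *)
Lemma differentiable_squeeze (R : realType) n (f : R * 'rV[R]_n -> R)
    (p : R * 'rV[R]_n) (q1 q2 : R * 'rV[R]_n -> 'rV[R]_n) (h : 'rV[R]_n -> R) :
  {for p, continuous q1} -> {for p, continuous q2} -> q2 p = q1 p -> continuous h ->
  (\forall p' \near p, f p' - f p <= jet (q1 p') (h (q1 p')) (p' - p)) ->
  (\forall p' \near p, jet (q2 p') (h (q2 p')) (p' - p) <= f p' - f p) ->
  differentiable f p /\ ('d f p : R * 'rV[R]_n -> R) = jet (q1 p) (h (q1 p)).
Proof.
move=> cq1 cq2 q21 ch Hu Hl.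
pose E (q : R * 'rV[R]_n -> 'rV[R]_n) p' :=
  n%:R * `|q p' - q1 p| + `|h (q p') - h (q1 p)|.
have small q eps : {for p, continuous q} -> q p = q1 p -> 0 < eps ->
    \forall p' \near p, E q p' < eps.
  move=> cq qp eps0.
  have cE : {for p, continuous (E q)}.
    apply: (@continuousD _ _ _ (fun p' => n%:R * `|q p' - q1 p|)
      (fun p' => `|h (q p') - h (q1 p)|)).
      apply: continuousM; first exact: cst_continuous.
      apply: (@continuous_comp _ _ _ (fun p' => q p' - q1 p) Num.norm).
        by apply: (@continuousB _ _ _ q (cst (q1 p))) => //; exact: cst_continuous.
      exact: norm_continuous.
    apply: (@continuous_comp _ _ _ (fun p' => h (q p') - h (q1 p)) Num.norm).
      apply: (@continuousB _ _ _ (h \o q) (cst (h (q1 p)))); last exact: cst_continuous.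
      by apply: continuous_comp => //; exact: ch.
    exact: norm_continuous.
  have E0 : E q p < eps by rewrite /E qp !subrr !normr0 mulr0 addr0.
  by have /(cvgr_lt _) /(_ eps E0) := cE.
have D : f \o shift p = cst (f p) + jet (q1 p) (h (q1 p)) +o_ (0 : R * 'rV[R]_n) id.
  apply/eqaddoP => eps eps0.
  have key : \forall p' \near p,
      `|f p' - f p - jet (q1 p) (h (q1 p)) (p' - p)| <= eps * `|p' - p|.
    near=> p'.
    have u : f p' - f p <= jet (q1 p') (h (q1 p')) (p' - p) by near: p'.
    have l : jet (q2 p') (h (q2 p')) (p' - p) <= f p' - f p by near: p'.
    have e1 : E q1 p' < eps by near: p'; exact: small.
    have e2 : E q2 p' < eps by near: p'; exact: small.
    have bnd q : E q p' < eps ->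
      `|jet (q p') (h (q p')) (p' - p) - jet (q1 p) (h (q1 p)) (p' - p)| <= eps * `|p' - p|.
      move=> /ltW Eq; rewrite jetB (le_trans (jet_le _ _ _))//.
      exact: ler_wpM2r.
    have := bnd _ e1; have := bnd _ e2.
    rewrite !ler_norml => /andP[b1 b2] /andP[b3 b4]; apply/andP; split; lra.
  move: key; rewrite (near_shift 0 p); apply: filterS => d.
  by rewrite /= subr0 addrK !fctE /jet !opprD !addrA.
have dE := diff_unique (@jet_continuous R n _ _) D.
split; last by rewrite dE.
apply/diff_locallyP; rewrite dE; split=> //.
exact: jet_continuous.
Unshelve. all: by end_near. Qed.

Section Smoothness.
Variables (R : realType) (n : nat) (H sigma : 'rV[R]_n -> R) (ts : R).
Hypothesis H0 : hypH0 H.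
Hypothesis sigma_cont : continuous sigma.
Hypothesis sigma_lip : [lipschitz sigma x | x in [set: 'rV[R]_n]].
Hypothesis unique_min : forall t x, 0 < t -> t < ts ->
  exists y, forall z, minimizers H sigma t x z -> z = y.

Notation V := (R * 'rV[R]_n)%type.

Definition foot (p : V) : 'rV[R]_n := xget 0 (minimizers H sigma p.1 p.2).

Lemma footP p : 0 < p.1 -> minimizers H sigma p.1 p.2 (foot p).
Proof.
move=> p0; have [y] := minimizer_exists H0 sigma_cont sigma_lip p.2 p0.
exact: xgetI.
Qed.

Lemma near_strip (p : V) : 0 < p.1 < ts -> \forall p' \near p, 0 < p'.1 < ts.
Proof.
move=> /andP[p0 p1]; have c1 : fst @ p --> p.1 by exact: cvg_fst.
have /(cvgr_gt _) /(_ _ p0) h0 := c1; have /(cvgr_lt _) /(_ _ p1) h1 := c1.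
by apply: filterS2 h0 h1 => q q0 q1; apply/andP.
Qed.

Lemma foot_continuous (p : V) : 0 < p.1 < ts -> {for p, continuous foot}.
Proof.
move=> pD; have /andP[p0 p1] := pD; have [B B0 HB] := cost_bound H0 sigma_lip.
apply: (@argmin_continuous R _ n (fun p => hopf_lax_cost H sigma p.1 p.2) foot p
  (`|p.2| + 1 + ts * B)).
- by case: p p0 {pD p1} => t x /= t0 y; exact: cost_continuous.
- by apply: filterS (near_strip pD) => q /andP[q0 _] y; exact: footP.
- have near2 : \forall q \near p, `|p.2 - q.2| < 1.
    have c2 : {for p, continuous (fun q : V => `|p.2 - q.2|)}.
      apply: (@continuous_comp _ _ _ (fun q : V => p.2 - q.2) Num.norm).
        apply: (@continuousB _ _ _ (cst p.2) snd); first exact: cst_continuous.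
        exact: cvg_snd.
      exact: norm_continuous.
    have z1 : `|p.2 - p.2| < 1 by rewrite subrr normr0.
    by have /(cvgr_lt _) /(_ _ z1) := c2.
  apply: filterS2 (near_strip pD) near2 => q /andP[q0 q1] pq.
  have := HB _ _ _ q0 (footP q0 q.2).
  have : q.1 * B <= ts * B by rewrite ler_wpM2r// ltW.
  have := ler_normB q.2 (q.2 - foot q); rewrite opprB [_ + (foot q - _)]addrC subrK.
  have := ler_normB p.2 (p.2 - q.2); rewrite opprB [_ + (q.2 - _)]addrC subrK; lra.
- move=> y my; have [y0 Hy0] := unique_min p.2 p0 p1.
  by rewrite (Hy0 y)// (Hy0 (foot p))//; exact: footP.
Qed.

Definition momentum (p : V) := fenchel_argmax H (p.1^-1 *: (p.2 - foot p)).

Lemma fenchel_argmax_velocity_continuous (p : V) (t : V -> R) (x y : V -> 'rV[R]_n) :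
  t p != 0 -> {for p, continuous t} -> {for p, continuous x} ->
  {for p, continuous y} ->
  {for p, continuous (fun q => fenchel_argmax H ((t q)^-1 *: (x q - y q)))}.
Proof.
move=> t0 ct cx cy.
apply: (@continuous_comp _ _ _ (fun q => (t q)^-1 *: (x q - y q)) (fenchel_argmax H)).
  by apply: continuousZ; [exact: continuousV|exact: continuousB].
exact: fenchel_argmax_continuous.
Qed.

(** For the upper bound the minimizer at [p] is kept and the end point moves; for
    the lower bound the minimizer at the moving point is tested at [p]. *)
Lemma hopf_lax_diff (p : V) : 0 < p.1 < ts ->
  differentiable (fun p : V => hopf_lax H sigma p.1 p.2) p /\
  ('d (fun p : V => hopf_lax H sigma p.1 p.2) p : V -> R)
    = jet (momentum p) (H (momentum p)).
Proof.
move=> pD; have /andP[p0 p1] := pD.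
have p0' : p.1 != 0 by rewrite gt_eqF.
have cH := hypH0_continuous H0; have cf := foot_continuous pD.
have uE (q : V) : 0 < q.1 -> hopf_lax H sigma q.1 q.2 = hopf_lax_cost H sigma q.1 q.2 (foot q).
  by move=> q0; apply: hopf_laxE; exact: footP.
pose q1 p' := fenchel_argmax H (p'.1^-1 *: (p'.2 - foot p)).
pose q2 p' := fenchel_argmax H (p.1^-1 *: (p.2 - foot p')).
apply: (@differentiable_squeeze R n (fun p : V => hopf_lax H sigma p.1 p.2) p q1 q2 H).
- apply: fenchel_argmax_velocity_continuous; [by []|exact: cvg_fst|exact: cvg_snd|].
  exact: cst_continuous.
- by apply: fenchel_argmax_velocity_continuous; [by []|exact: cst_continuous..|].
- by [].
- exact: cH.
- apply: filterS (near_strip pD) => q /andP[q0 _].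
  rewrite (uE q)// (uE p)//.
  apply: le_trans (cost_increment sigma H0 p.2 p0 q0 (erefl (q1 q))).
  rewrite lerD2r; exact: footP.
- apply: filterS (near_strip pD) => q /andP[q0 _].
  rewrite (uE q)// (uE p)// -[q - p]opprB linearN lerNl opprB.
  apply: le_trans (cost_increment sigma H0 q.2 q0 p0 (erefl (q2 q))).
  rewrite lerD2r; exact: footP.
Qed.

Lemma hopf_lax_C1 :
  C1_on [set p : V | 0 < p.1 < ts] (fun p : V => hopf_lax H sigma p.1 p.2).
Proof.
move=> p /= pD; have [df _] := hopf_lax_diff pD; split=> // v.
have /andP[p0 p1] := pD.
have c : {for p, continuous (fun q => jet (momentum q) (H (momentum q)) v)}.
  have cm : {for p, continuous momentum}.
    apply: fenchel_argmax_velocity_continuous; first by rewrite gt_eqF.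
    - exact: cvg_fst.
    - exact: cvg_snd.
    - exact: foot_continuous.
  apply: (@continuousB _ _ _ (fun q => dot (momentum q) v.2)
    (fun q => H (momentum q) * v.1)).
    by apply: continuous_dot; [exact: cm|exact: cst_continuous].
  apply: continuousM; last exact: cst_continuous.
  apply: (@continuous_comp _ _ _ momentum H); first exact: cm.
  exact: hypH0_continuous.
have E : {near p, (fun q => jet (momentum q) (H (momentum q)) v) =1
    (fun q => 'd (fun p : V => hopf_lax H sigma p.1 p.2) q v)}.
  by apply: filterS (near_strip pD) => q qD; rewrite (hopf_lax_diff qD).2.
have c' : 'd (fun p : V => hopf_lax H sigma p.1 p.2) q v @[q --> p] -->
    jet (momentum p) (H (momentum p)) v by exact: cvg_trans (near_eq_cvg E) c.
have Ep : jet (momentum p) (H (momentum p)) v =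
    'd (fun p : V => hopf_lax H sigma p.1 p.2) p v by rewrite (hopf_lax_diff pD).2.
by rewrite Ep in c'.
Qed.

End Smoothness.

Theorem theorem4p2 (R : realType) (n : nat) (T : R)
    (H sigma : 'rV[R]_n -> R) (tstar : R)
    (T_gt0 : 0 < T)
    (H0 : hypH0 H)
    (H1 : hypH1 T H sigma)
    (sigma_lip : [lipschitz sigma x | x in [set: 'rV[R]_n]])
    (sigma_C1 : C1_on [set: 'rV[R]_n] sigma)
    (tstar_gt0 : 0 < tstar) (tstar_leT : tstar <= T)
    (ell_singleton : forall x : 'rV[R]_n,
       exists y : 'rV[R]_n, minimizers H sigma tstar x = [set y]) :
  C1_on [set p : R * 'rV[R]_n | 0 < p.1 < tstar]
    (fun p : R * 'rV[R]_n => hopf_lax H sigma p.1 p.2).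
Proof.
have sigma_cont := H1.1.
apply: hopf_lax_C1 => // t x t0 tts.
exact: unique_minimizer_below ell_singleton t0 tts.
Qed.
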